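(* Let $m\ge 1$ be an integer, let $M=(M_{i,j})_{i,j=0}^{m-1}$ be a real $m\times m$ matrix, and let $\alpha$ be a real number with $\alpha\neq m-1,m-2,m-3,\ldots$. Consider the discrete Laguerre-Sobolev bilinear form on real polynomials $$\langle p,q\rangle=\int_0^\infty p(x)q(x)\,\mu_{\alpha-m}(x)\,dx+\mathbb{P}(0)\,M\,\mathbb{Q}(0)^T,$$ where $\mathbb{P}(0)=(p(0),p'(0),\ldots,p^{(m-1)}(0))$ and $\mathbb{Q}(0)=(q(0),q'(0),\ldots,q^{(m-1)}(0))$. For $l=1,\ldots,m$ define $$\mathcal{R}_l(x)=\frac{\Gamma(\alpha-m+l)}{(m-l)!}(x+1)_{m-l}+(l-1)!\,\frac{\Gamma(\alpha+1+x)}{\Gamma(1+x)}\sum_{i=0}^{m-1}\frac{(-1)^iM_{l-1,i}}{\Gamma(\alpha+i+1)}(x-i+1)_i .$$ Then the following conditions are equivalent: 1. The bilinear form $\langle\cdot,\cdot\rangle$ has a sequence $(q_n)_n$ of (left) orthogonal polynomials. 2. The $m\times m$ Casorati determinant $\Omega(n)=\det\left(\mathcal{R}_i(n-j)\right)_{i,j=1}^m$ does not vanish for $n\ge 0$. Moreover, if one of these properties holds, the polynomials defined by $$q_n(x)=\begin{vmatrix} L_n^\alpha(x)&L_{n-1}^\alpha(x)&\cdots&L_{n-m}^\alpha(x)\\ \mathcal{R}_1(n)&\mathcal{R}_1(n-1)&\cdots&\mathcal{R}_1(n-m)\\ \vdots&\vdots&\ddots&\vdots\\ \mathcal{R}_m(n)&\mathcal{R}_m(n-1)&\cdots&\mathcal{R}_m(n-m)\end{vmatrix},\qquad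 n\ge0,$$ (with $L_k^\alpha=0$ for $k<0$) are (left) orthogonal with respect to $\langle\cdot,\cdot\rangle$.
   Context: $(a)_k=a(a+1)\cdots(a+k-1)$, $(a)_0=1$, is the Pochhammer symbol. $L_n^{\alpha}(x)=\sum_{j=0}^n\frac{(-x)^j}{j!}\binom{n+\alpha}{n-j}$ are the Laguerre polynomials. For $\beta\in\mathbb{R}$, $\beta\ne-1,-2,\ldots$, $\mu_\beta$ denotes the orthogonalizing weight for the Laguerre polynomials $(L_n^\beta)_n$: for $\beta>-1$ it is $\mu_\beta(x)=x^\beta e^{-x}$, $x>0$; for $\beta<-1$ it is a (non-positive) measure with moments $\int x^k\,d\mu_\beta=\Gamma(\beta+k+1)$, $k\ge 0$, so that $x^m\mu_{\alpha-m}=\mu_\alpha$; integrals of polynomials against $\mu_\beta$ are determined by these moments. A sequence of real polynomials $(q_n)_{n\ge0}$ with $\deg q_n=n$ is (left) orthogonal with respect to a (not necessarily symmetric) bilinear form $B$ on real polynomials if, for every $n\ge 0$, $B(q_n,q)=0$ for all polynomials $q$ with $\deg q<n$, and $B(q_n,q_n)\neq0$. The function $1/\Gamma$ is taken to be $0$ at non-positive integers; when $\alpha$ is a positive integer (then $\alpha\ge m$), $\frac{\Gamma(\alpha+1+x)}{\Gamma(1+x)}=(x+1)_\alpha$.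
   Formalization: The ''Moreover'' is false for non-symmetric M: the printed q_n satisfy ⟨p,q_n⟩=0 for deg p<n. The formal version asserts this right orthogonality, and left orthogonality for the q_n built with M_{i,l-1} in place of M_{l-1,i}; for symmetric M this is the printed claim. *)

(* Defs.v *)
From HB Require Import structures.
From mathcomp Require Import all_boot all_order all_algebra.
From mathcomp Require Import all_classical all_reals all_analysis.
Set Implicit Arguments.
Unset Strict Implicit.
Unset Printing Implicit Defensive.
Import Order.TTheory GRing.Theory Num.Theory.
Import numFieldNormedType.Exports.

Local Open Scope classical_set_scope.
Local Open Scope ring_scope.

Section LaguerreSobolev.
Context {R : realType}.
Implicit Types (a b x alpha : R) (p q : {poly R}).

Definition poch a (k : nat) : R := \prod_(i < k) (a + i%:R).

Definition gbinom a (k : nat) : R := (\prod_(i < k) (a - i%:R)) / k`!%:R.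

Definition euler_integral x : R :=
  \int[lebesgue_measure]_(t in `]0, +oo[) (t `^ (x - 1) * expR (- t)).

(* For x <= 0 this is Gamma x = Gamma (x + k) / (x)_k with k large enough for
   x + k to be positive. At the poles 0, -1, -2, ... we have (x)_k = 0, so
   Gamma x = 0 and also (Gamma x)^-1 = 0, which is the value of the entire
   function 1/Gamma there. *)
Definition Gamma x : R :=
  if 0 < x then euler_integral x
  else let k := `|Num.floor x|%N.+1 in
       euler_integral (x + k%:R) / poch x k.

Definition laguerre (n : nat) alpha : {poly R} :=
  \poly_(j < n.+1)
    ((-1) ^+ j / j`!%:R * gbinom (n%:R + alpha) (n - j)).

(* The integral of p against mu_b: the weight x^b e^-x on the half-line for
   b > -1, and the measure given by its moments Gamma (b + k + 1) otherwise. *)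
Definition laguerre_integral b p : R :=
  if -1 < b then
    \int[lebesgue_measure]_(x in `]0, +oo[) (p.[x] * (x `^ b * expR (- x)))
  else \sum_(k < size p) p`_k * Gamma (b + k%:R + 1).

Definition jet0 (m : nat) p : 'rV[R]_m := \row_(i < m) (p^`(i)).[0].

Definition sobolev_form (m : nat) alpha (M : 'M[R]_m) p q : R :=
  laguerre_integral (alpha - m%:R) (p * q)
  + (jet0 m p *m M *m (jet0 m q)^T) ord0 ord0.

Definition left_orthogonal (B : {poly R} -> {poly R} -> R)
    (q : nat -> {poly R}) : Prop :=
  forall n, [/\ size (q n) = n.+1,
                forall p, (size p <= n)%N -> B (q n) p = 0
              & B (q n) (q n) != 0].

Definition right_orthogonal (B : {poly R} -> {poly R} -> R)
    (q : nat -> {poly R}) : Prop :=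
  left_orthogonal (fun p1 p2 => B p2 p1) q.

Definition Gamma_ratio alpha x : R :=
  if (alpha \is a Num.nat) && (0 < alpha) then poch (x + 1) (Num.truncn alpha)
  else Gamma (alpha + 1 + x) * (Gamma (1 + x))^-1.

(* The index l : 'I_m starts at 0: calR alpha M l is R_(l+1). *)
Definition calR (m : nat) alpha (M : 'M[R]_m) (l : 'I_m) x : R :=
  Gamma (alpha - m%:R + l.+1%:R) / (m - l.+1)`!%:R * poch (x + 1) (m - l.+1)
  + l`!%:R * Gamma_ratio alpha x *
    \sum_(i < m) (-1) ^+ i * M l i / Gamma (alpha + i%:R + 1)
                 * poch (x - i%:R + 1) i.

Definition casorati (m : nat) alpha (M : 'M[R]_m) (n : nat) : R :=
  \det (\matrix_(i < m, j < m) calR alpha M i (n%:R - j.+1%:R)).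

(* At x = n >= 0, calR alpha M l x is the value of sobolev_form alpha M on
   'X^l (first argument) and laguerre n alpha (second argument). Hence these
   polynomials are orthogonal as second arguments of the form for M, and as
   first arguments of the form for M^T. *)
Definition sobolev_poly (m : nat) alpha (M : 'M[R]_m) (n : nat) : {poly R} :=
  \det (col_mx
    (\row_(j < 1 + m) (if (j <= n)%N then laguerre (n - j) alpha else 0))
    (\matrix_(i < m, j < 1 + m) (calR alpha M i (n%:R - j%:R))%:P)).

End LaguerreSobolev.

(* Main.v *)
Require Import Defs.
From mathcomp Require Import all_boot all_order all_algebra.
From mathcomp Require Import all_classical all_reals all_analysis.
From mathcomp Require Import perm measurable_realfun.
From mathcomp Require Import ring lra zify.
Set Implicit Arguments.
Unset Strict Implicit.
Unset Printing Implicit Defensive.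
Import Order.TTheory GRing.Theory Num.Theory.
Import numFieldNormedType.Exports.
Local Open Scope classical_set_scope.
Local Open Scope ring_scope.


(** Everything rests on evaluating the form on a monomial and a Laguerre
    polynomial.  The moments Gamma (beta + k + 1) and the Chu-Vandermonde
    identity [sum_poch_vandermonde] give, with beta = alpha - m,

      int x^k L_n^alpha dmu_beta = Gamma (beta + k + 1) (m - k)_n / n!

    ([laguerre_moment]).  For k >= m the jet at 0 of x^k is zero, so
    <x^k, L_n^alpha> vanishes exactly when k < n + m ([sobolev_form_high]).
    For k < m the jet part supplies the second summand of calR, and
    <x^k, L_n^alpha> is the value at n of the function calR with index k
    ([calR_form]).  At x = -1, ..., -m that function loses its second summand
    and vanishes exactly for x >= -(m - k - 1) ([calR_neg_eq0]), so the columns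
    of negative index behave like Laguerre polynomials of negative index on
    all the pairings that matter.

    Expand the determinant defining q_n along its first row: pairing x^k with
    q_n replaces that row by the pairings of x^k with L_n, ..., L_(n-m).  For
    k < n this is a row of the matrix, or zero; for k = n it differs from one
    of these only in its last entry, by a nonzero amount.  Hence
    ([sobolev_poly_pairing])

      <x^k, q_n> = 0 for k < n,    <x^n, q_n> = kappa Omega(n + 1), kappa <> 0,

    while the coefficient of x^n in q_n is a nonzero multiple of Omega(n).
    If Omega never vanishes, the q_n are therefore orthogonal as second
    arguments.

    Conversely, an orthogonal sequence triangularizes the Gram matrices of the
    monomials, so these are invertible ([left_orthogonal_gram]).  Then
    Omega(n) <> 0 follows by induction: Omega(0) is the determinant of an
    anti-triangular matrix, and if Omega(n) <> 0 = Omega(n + 1), then q_n is a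
    nonzero polynomial of degree n in the kernel of the Gram matrix of size
    n + 1.

    Invertibility of the Gram matrices does not distinguish left from right,
    and transposing M exchanges the arguments of the form.  So the Casorati
    determinants of M are all nonzero if and only if those of M^T are, and the
    polynomials built from M^T are orthogonal as first arguments.

    The analytic input is that Euler's integral converges for s > 0, is
    positive and satisfies Gamma (s + 1) = s Gamma s. *)

(** * Euler's integral *)

(** The integrand t^(s-1) e^-t is unbounded at 0 when s < 1, so the half-line
    is exhausted by the closed half-lines starting at 1/(n+1), and monotone
    convergence brings in the limit of F at 0. *)
Lemma ge0_FTC_itv0y (R : realType) (f F : R -> R) (l0 l : R) :
  (forall x : R, 0 < x -> 0 <= f x) ->
  (forall x : R, 0 < x -> {for x, continuous f}) ->
  (forall x : R, 0 < x -> is_derive x 1 F (f x)) ->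
  F x @[x --> 0^'+] --> l0 -> F x @[x --> +oo] --> l ->
  (\int[lebesgue_measure]_(x in `]0%R, +oo[) (f x)%:E = (l - l0)%:E)%E.
Proof.
move=> f0 cf dF Fl0 Fl.
pose D := fun n : nat => `[(n.+1%:R : R)^-1, +oo[%classic.
have Dpos n x : D n x -> 0 < x.
  by rewrite /D /= in_itv /= andbT; apply: lt_le_trans; rewrite invr_gt0.
have DE : `](0 : R), +oo[%classic = \bigcup_n D n.
  apply/seteqP; split => x /=; last first.
    by move=> [n _ /Dpos x0]; rewrite in_itv /= x0.
  rewrite in_itv /= andbT => x0.
  exists (Num.truncn x^-1) => //; rewrite /D /= in_itv /= andbT.
  rewrite -[leRHS]invrK lef_pV2 ?posrE ?invr_gt0 //.
  exact/ltW/truncnS_gt.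
have mf : measurable_fun `](0 : R), +oo[ f.
  apply: open_continuous_measurable_fun => // x.
  by rewrite inE /= in_itv /= andbT => /cf.
have IE n : (\int[lebesgue_measure]_(x in D n) (f x)%:E
             = (l - F n.+1%:R^-1)%:E)%E.
  have n0 : (0 : R) < n.+1%:R^-1 by rewrite invr_gt0.
  rewrite (@ge0_continuous_FTC2y _ f F _ l) //.
  - by move=> x hx; apply: f0; apply: lt_le_trans hx.
  - apply: continuous_in_subspaceT => x.
    by rewrite inE => /Dpos /cf.
  - by move=> x hx; have [] := dF _ (lt_trans n0 hx).
  - apply: cvg_at_right_filter; apply: differentiable_continuous.
    by apply/derivable1_diffP; have [] := dF _ n0.
  - move=> x; rewrite in_itv /= andbT => hx; rewrite derive1E.
    by have [_ ->] := dF _ (lt_trans n0 hx).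
rewrite DE.
have H := @ge0_nondecreasing_set_cvg_integral _ (measurableTypeR R) R D
  (EFin \o f) lebesgue_measure.
apply: (cvg_unique _ (H _ _ _ _)) => //.
- move=> m n mn; rewrite subsetEset; apply: subset_itvr; rewrite bnd_simp.
  by rewrite lef_pV2 ?posrE // ler_nat.
- by move=> n; apply: measurable_itv.
- move=> n; apply/measurable_EFinP; apply: measurable_funS mf => //.
  by move=> x /Dpos; rewrite /= in_itv /= andbT.
- by move=> n x /Dpos /f0; rewrite lee_fin.
- rewrite /comp (funext IE).
  apply: cvg_EFin; first exact: nearW.
  apply: cvgB; first exact: cvg_cst.
  move/cvg_at_rightP: Fl0; apply; split; first by move=> n; rewrite invr_gt0.
  exact: cvg_harmonic.
Qed.

Lemma is_derive_continuous (R : realType) (f : R -> R) (x df : R) :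
  is_derive x 1 f df -> f y @[y --> x] --> f x.
Proof.
by case=> df_x _; apply: differentiable_continuous; apply/derivable1_diffP.
Qed.

(** Raise t / (2s) <= exp (t / (2s)) to the power s. *)
Lemma powR_le_expR_half (R : realType) (s t : R) :
  0 < s -> 0 < t -> t `^ s <= (2 * s) `^ s * expR (t / 2).
Proof.
move=> s0 t0.
have s2 : 0 < 2 * s by rewrite mulr_gt0.
have -> : expR (t / 2) = expR (t / (2 * s)) `^ s.
  rewrite -expRM; congr expR; field.
  by rewrite gt_eqF.
rewrite -powRM ?expR_ge0 ?(ltW s2) //.
apply: ge0_ler_powR; rewrite ?nnegrE ?(ltW s0) ?(ltW t0) //.
  by rewrite mulr_ge0 ?expR_ge0 ?(ltW s2).
rewrite -ler_pdivrMl // mulrC.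
by apply: le_trans (expR_ge1Dx _); rewrite lerDr.
Qed.

Definition gamma_density (R : realType) (s t : R) : R :=
  t `^ (s - 1) * expR (- t).

Lemma gamma_density_ge0 (R : realType) (s t : R) : 0 <= gamma_density s t.
Proof. by rewrite mulr_ge0 ?powR_ge0 ?expR_ge0. Qed.

Lemma gamma_density_le (R : realType) (s t : R) : 0 < s -> 0 < t ->
  gamma_density (s + 1) t <= (2 * s) `^ s * expR (- t / 2).
Proof.
move=> s0 t0; rewrite /gamma_density addrK.
rewrite [leRHS](_ : _ = (2 * s) `^ s * expR (t / 2) * expR (- t)).
  by rewrite ler_wpM2r ?expR_ge0 // powR_le_expR_half.
by rewrite -mulrA -expRD; congr (_ * expR _); field.
Qed.

(** This is the identity integrated by parts in the functional equation of
    Gamma. *)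
Lemma is_derive_gamma_density (R : realType) (s t : R) : 0 < t ->
  is_derive t 1 (gamma_density (s + 1))
    (s * gamma_density s t - gamma_density (s + 1) t).
Proof.
move=> t0; rewrite /gamma_density addrK.
have H := is_derive1_powR s t0.
apply: is_derive_eq; rewrite /GRing.scale /=; ring.
Qed.

Lemma continuous_gamma_density (R : realType) (s t : R) : 0 < t ->
  {for t, continuous (gamma_density s)}.
Proof.
move=> t0; apply: differentiable_continuous; apply/derivable1_diffP.
by rewrite -[s](subrK 1); have [] := is_derive_gamma_density (s - 1) t0.
Qed.

Lemma is_derive_expR_half (R : realType) (t : R) :
  is_derive t 1 (fun t : R => - 2 * expR (- t / 2)) (expR (- t / 2)).
Proof. apply: is_derive_eq; rewrite /GRing.scale /=; by field. Qed.

Lemma cvg_expR_half (R : realType) :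
  expR (- t / 2) @[t --> (+oo : set_system R)] --> (0 : R).
Proof.
rewrite (_ : (fun t : R => expR (- t / 2)) =
  (fun z : R => expR (- z)) \o (fun t => 2^-1 * t)); last first.
  by apply/funext => t /=; rewrite mulNr mulrC.
apply: (@cvg_comp _ _ _ _ _ _ (pinfty_nbhs R)); last exact: cvgr_expR.
exact: gt0_cvgMry.
Qed.

Lemma continuous_expR_half (R : realType) :
  continuous (fun t : R => expR (- t / 2)).
Proof.
by move=> t; apply: differentiable_continuous; apply/derivable1_diffP.
Qed.

Lemma integral_expR_half (R : realType) :
  (\int[lebesgue_measure]_(t in `](0%R : R), +oo[) (expR (- t / 2))%:E
   = 2%:E)%E.
Proof.
rewrite (_ : 2%:E = (0 - - 2)%:E)%E; last by rewrite sub0r opprK.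
apply: (@ge0_FTC_itv0y _ _ (fun t : R => - 2 * expR (- t / 2))) => //.
- by move=> t _; exact: continuous_expR_half.
- by move=> t _; exact: is_derive_expR_half.
- rewrite -[X in _ --> X](_ : -2 * expR (- (0 : R) / 2) = -2); last first.
    by rewrite oppr0 mul0r expR0 mulr1.
  apply: cvg_at_right_filter.
  exact: (is_derive_continuous (is_derive_expR_half 0)).
- rewrite -[X in _ --> X](mulr0 (- 2 : R)).
  by apply: cvgMl_tmp; exact: cvg_expR_half.
Qed.

Lemma measurable_gamma_density (R : realType) (s : R) :
  measurable_fun `](0 : R), +oo[ (gamma_density s).
Proof.
apply: open_continuous_measurable_fun => // t.
by rewrite inE /= in_itv /= andbT => /continuous_gamma_density; apply.
Qed.

(** The derivative of t^s e^-t changes sign at t = s.  A multiple of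
    e^(-t/2) dominating t^s e^-t makes it nonnegative, so that the fundamental
    theorem of calculus for nonnegative functions applies; both the
    integrability of t^(s-1) e^-t and the functional equation are read off from
    the resulting finite integral. *)
Lemma gamma_density_FTC_ge0 (R : realType) (s t : R) : 0 < s -> 0 < t ->
  0 <= s * gamma_density s t - gamma_density (s + 1) t
       + (2 * s) `^ s * expR (- t / 2).
Proof.
move=> s0 t0; rewrite -addrA; apply: addr_ge0.
  by rewrite mulr_ge0 ?gamma_density_ge0 ?ltW.
by rewrite addrC subr_ge0 gamma_density_le.
Qed.

Lemma gamma_density_FTC (R : realType) (s : R) : 0 < s ->
  (\int[lebesgue_measure]_(t in `](0%R : R), +oo[)
    (s * gamma_density s t - gamma_density (s + 1) t
      + (2 * s) `^ s * expR (- t / 2))%:E = (2 * (2 * s) `^ s)%:E)%E.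
Proof.
move=> s0; set C := (2 * s) `^ s.
rewrite (_ : 2 * C = 0 - - 2 * C); last by rewrite sub0r mulNr opprK.
apply: (@ge0_FTC_itv0y _ _
  (fun t : R => gamma_density (s + 1) t + C * (- 2 * expR (- t / 2)))).
- by move=> t; exact: gamma_density_FTC_ge0.
- move=> t t0; apply: cvgD.
    apply: cvgB; last exact: continuous_gamma_density.
    by apply: cvgMl_tmp; exact: continuous_gamma_density.
  by apply: cvgMl_tmp; exact: continuous_expR_half.
- move=> t t0; have H1 := is_derive_gamma_density s t0.
  by have H2 := is_derive_expR_half t; apply: is_derive_eq.
- rewrite -[X in _ --> X]add0r; apply: cvgD.
    rewrite /gamma_density addrK.
    apply: (@squeeze_cvgr _ _ _ _ (fun=> 0) (fun t => t `^ s)).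
    + near=> t; rewrite mulr_ge0 ?powR_ge0 ?expR_ge0 //=.
      by rewrite ler_piMr ?powR_ge0 // -[leRHS]expR0 ler_expR oppr_le0.
    + exact: cvg_cst.
    + exact: powR_cvg0.
  rewrite mulrC; apply: cvgMl_tmp.
  rewrite -[X in _ --> X](_ : -2 * expR (- (0 : R) / 2) = -2); last first.
    by rewrite oppr0 mul0r expR0 mulr1.
  apply: cvg_at_right_filter.
  exact: (is_derive_continuous (is_derive_expR_half 0)).
- rewrite -[X in _ --> X](addr0 (0 : R)); apply: cvgD.
    apply: (@squeeze_cvgr _ _ _ _ (fun=> 0) (fun t => C * expR (- t / 2))).
    + by near=> t; rewrite gamma_density_ge0 gamma_density_le.
    + exact: cvg_cst.
    + rewrite -[X in _ --> X](mulr0 C); apply: cvgMl_tmp; exact: cvg_expR_half.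
  rewrite -[X in _ --> X](mulr0 C); apply: cvgMl_tmp.
  rewrite -[X in _ --> X](mulr0 (- 2 : R)).
  by apply: cvgMl_tmp; exact: cvg_expR_half.
Unshelve. all: by end_near. Qed.

Definition integrable_pos (R : realType) (f : R -> R) : Prop :=
  (@lebesgue_measure R).-integrable `](0 : R), +oo[ (EFin \o f).

Lemma integrable_posZ (R : realType) (k : R) (f : R -> R) :
  integrable_pos f -> integrable_pos (fun t => k * f t).
Proof. by move=> intf; exact: (integrableZl _ k intf). Qed.

Lemma integrable_posD (R : realType) (f g : R -> R) :
  integrable_pos f -> integrable_pos g -> integrable_pos (fun t => f t + g t).
Proof. by move=> intf intg; exact: (integrableD _ intf intg). Qed.

Lemma integrable_posB (R : realType) (f g : R -> R) :
  integrable_pos f -> integrable_pos g -> integrable_pos (fun t => f t - g t).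
Proof. by move=> intf intg; exact: (integrableB _ intf intg). Qed.

Lemma integrable_expR_half (R : realType) :
  integrable_pos (fun t : R => expR (- t / 2)).
Proof.
apply/integrableP; split.
  apply/measurable_EFinP; apply: open_continuous_measurable_fun => // t _.
  exact: continuous_expR_half.
under eq_integral do rewrite /= ger0_norm ?expR_ge0 //.
by rewrite integral_expR_half ltry.
Qed.

Lemma integrable_gamma_density (R : realType) (s : R) : 0 < s ->
  integrable_pos (gamma_density s).
Proof.
move=> s0; pose C := (2 * s) `^ s.
have intE : integrable_pos (fun t : R => expR (- t / 2)).
  exact: integrable_expR_half.
have intS : integrable_pos (gamma_density (s + 1)).
  apply: (le_integrable _ _ _ (integrable_posZ C intE)) => //.
  - by apply/measurable_EFinP; exact: measurable_gamma_density.
  - move=> t; rewrite /= in_itv /= andbT => t0.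
    rewrite lee_fin (ger0_norm (gamma_density_ge0 _ _)).
    rewrite (@ger0_norm _ (C * expR (- t / 2))) ?gamma_density_le //.
    by rewrite mulr_ge0 ?powR_ge0 ?expR_ge0.
have intF : integrable_pos (fun t => s * gamma_density s t
    - gamma_density (s + 1) t + C * expR (- t / 2)).
  apply/integrableP; split.
    apply/measurable_EFinP; apply: measurable_funD.
      apply: measurable_funB; last exact: measurable_gamma_density.
      by apply: measurable_funM => //; exact: measurable_gamma_density.
    apply: measurable_funM => //.
    by case/integrableP: intE => /measurable_EFinP.
  apply: (@le_lt_trans _ _ (2 * C)%:E); last exact: ltry.
  rewrite -gamma_density_FTC // le_eqVlt; apply/orP; left; apply/eqP.
  apply: eq_integral => t; rewrite inE /= in_itv /= andbT => t0; congr EFin.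
  by rewrite ger0_norm // gamma_density_FTC_ge0.
(* s g_s is the combination in intF plus g_(s+1) minus C e^(-t/2). *)
have := integrable_posZ s^-1 (integrable_posB (integrable_posD intF intS)
   (integrable_posZ C intE)).
congr integrable_pos; apply/funext => t.
by field; rewrite gt_eqF.
Qed.

Lemma euler_integralE (R : realType) (s : R) :
  euler_integral s
  = \int[lebesgue_measure]_(t in `](0 : R), +oo[) gamma_density s t.
Proof. by []. Qed.

Lemma euler_integralD1 (R : realType) (s : R) : 0 < s ->
  euler_integral (s + 1) = s * euler_integral s.
Proof.
move=> s0; pose C := (2 * s) `^ s.
have intE := integrable_expR_half R.
have E : \int[lebesgue_measure]_(t in `](0 : R), +oo[) expR (- t / 2) = 2.
  by rewrite /Rintegral integral_expR_half.
have intS := integrable_gamma_density s0.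
have intS1 : integrable_pos (gamma_density (s + 1)).
  by apply: integrable_gamma_density; rewrite addr_gt0.
have intZ := integrable_posZ s intS.
have := gamma_density_FTC s0; rewrite -/C.
move=> /(congr1 fine); rewrite -/(Rintegral _ _ _) RintegralD //=.
- rewrite RintegralB // !RintegralZl // E -!euler_integralE.
  by rewrite [2 * C]mulrC -[RHS]add0r => /addIr/eqP; rewrite subr_eq0 => /eqP.
- exact: integrable_posB.
- exact: integrable_posZ.
Qed.

Lemma euler_integral1 (R : realType) : euler_integral 1 = 1 :> R.
Proof.
have E : (\int[lebesgue_measure]_(t in `](0%R : R), +oo[)
    (gamma_density 1 t)%:E = (0 - - 1)%:E)%E.
  apply: (@ge0_FTC_itv0y _ _ (fun t : R => - expR (- t))).
  - by move=> t _; exact: gamma_density_ge0.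
  - by move=> t; exact: continuous_gamma_density.
  - move=> t t0; rewrite /gamma_density subrr powRr0 mul1r.
    apply: is_derive_eq; rewrite /GRing.scale /=; ring.
  - rewrite -[X in _ --> X](_ : - expR (- (0 : R)) = - 1); last first.
      by rewrite oppr0 expR0.
    apply: cvg_at_right_filter.
    by apply: (is_derive_continuous (f := fun t : R => - expR (- t))).
  - by rewrite -oppr0; apply: cvgN; exact: cvgr_expR.
by rewrite euler_integralE /Rintegral E /= sub0r opprK.
Qed.

Lemma gamma_density_ge_on12 (R : realType) (s t : R) : 0 < s ->
  1 <= t <= 2 -> 2^-1 * expR (- 2) <= gamma_density s t.
Proof.
move=> s0 /andP[t1 t2]; have t0 : 0 < t by apply: lt_le_trans t1.
have le1 : 2^-1 <= t `^ (s - 1).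
  apply: (@le_trans _ _ (t `^ (-1))).
    by rewrite powR_inv1 ?(ltW t0) // lef_pV2 ?posrE.
  by apply: ler_powR => //; rewrite lerBrDr addNr ltW.
have le2 : expR (- 2) <= expR (- t) by rewrite ler_expR lerN2.
by apply: ler_pM; rewrite ?expR_ge0 ?invr_ge0.
Qed.

Lemma euler_integral_gt0 (R : realType) (s : R) : 0 < s -> 0 < euler_integral s.
Proof.
move=> s0; rewrite euler_integralE.
have intS := integrable_gamma_density s0.
have sub : `[1 : R, 2] `<=` `](0 : R), +oo[.
  move=> t /=; rewrite !in_itv /= => /andP[t1 _].
  by rewrite andbT (lt_le_trans _ t1).
have H : (\int[lebesgue_measure]_(t in `[(1 : R)%R, 2%R])
      cst (2^-1 * expR (- 2))%R%:E t
    <= \int[lebesgue_measure]_(t in `](0%R : R), +oo[)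
      (gamma_density s t)%:E)%E.
  apply: (@le_trans _ _ (\int[lebesgue_measure]_(t in `[(1 : R)%R, 2%R])
      (gamma_density s t)%:E)%E).
    apply: ge0_le_integral => //.
    - by move=> t _; rewrite lee_fin mulr_ge0 ?expR_ge0.
    - apply/measurable_EFinP; apply: measurable_funS sub _ => //.
      exact: measurable_gamma_density.
    - move=> t; rewrite /= in_itv /= => t12.
      by rewrite lee_fin gamma_density_ge_on12.
  apply: ge0_subset_integral => //.
  - by apply/measurable_EFinP; exact: measurable_gamma_density.
  - by move=> t _; rewrite lee_fin gamma_density_ge0.
rewrite /Rintegral fine_gt0 //; apply/andP; split; last first.
  by rewrite ltey_eq (integrable_fin_num _ intS).
apply: lt_le_trans H; rewrite integral_cst //=.
rewrite lebesgue_measure_itv /= lte_fin ltr1n.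
rewrite -EFinB -EFinM lte_fin.
by rewrite !mulr_gt0 ?expR_gt0 ?invr_gt0 // subr_gt0 ltr1n.
Qed.

(** * Pochhammer symbols and the Gamma function *)

Lemma pochS (R : realType) (x : R) (k : nat) :
  poch x k.+1 = x * poch (x + 1) k.
Proof.
rewrite /poch big_ord_recl addr0; congr (_ * _); apply: eq_bigr => i _.
by rewrite /= /bump leq0n natrD addrA.
Qed.

Lemma pochSr (R : realType) (x : R) (k : nat) :
  poch x k.+1 = poch x k * (x + k%:R).
Proof. by rewrite /poch big_ord_recr. Qed.

Lemma poch0 (R : realType) (x : R) : poch x 0 = 1.
Proof. by rewrite /poch big_ord0. Qed.

Lemma poch_eq0 (R : realType) (x : R) (k : nat) :
  (poch x k == 0) = [exists i : 'I_k, x == - i%:R].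
Proof.
apply/eqP/existsP => [/eqP|[i /eqP ->]].
  by rewrite prodf_seq_eq0 => /hasP[i _] /=; rewrite addr_eq0; exists i.
by apply/eqP/prodf_eq0; exists i; rewrite // addNr.
Qed.

Lemma natr_fact_neq0 (R : realType) (n : nat) : (n`!%:R : R) != 0.
Proof. by rewrite pnatr_eq0 -lt0n fact_gt0. Qed.

Lemma poch_natE (R : realType) (n k : nat) :
  poch (n.+1%:R : R) k = (n + k)`!%:R / n`!%:R.
Proof.
elim: k => [|k IH]; first by rewrite poch0 addn0 divff ?natr_fact_neq0.
rewrite pochSr IH addnS factS natrM -natrD addSn; field; exact: natr_fact_neq0.
Qed.

Lemma poch_negnat_eq0 (R : realType) (t k : nat) :
  (poch (- t%:R : R) k == 0) = (t < k)%N.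
Proof.
rewrite poch_eq0; apply/existsP/idP => [[i]|tk].
  by rewrite eqr_opp eqr_nat => /eqP ->.
by exists (Ordinal tk).
Qed.

Lemma Gamma_gt0E (R : realType) (x : R) : 0 < x -> Gamma x = euler_integral x.
Proof. by rewrite /Gamma => ->. Qed.

Lemma Gamma_le0E (R : realType) (x : R) (k : nat) : x <= 0 ->
  Num.floor x = - k%:Z -> Gamma x = euler_integral (x + k.+1%:R) / poch x k.+1.
Proof. by move=> x0 fx; rewrite /Gamma ltNge x0 /= fx abszN absz_nat. Qed.

Lemma Gamma_pole (R : realType) (n : nat) : Gamma (- n%:R : R) = 0.
Proof.
rewrite (@Gamma_le0E _ _ n) ?oppr_le0 //.
  have -> : poch (- n%:R : R) n.+1 = 0 by rewrite pochSr addNr mulr0.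
  by rewrite invr0 mulr0.
have -> : - n%:R = (- n%:Z)%:~R :> R by rewrite mulrNz.
exact: intrKfloor.
Qed.

(** For x < -1 the shift by 1 raises the floor by 1, so that Gamma x and
    Gamma (x + 1) are defined from the same value of Euler's integral; for
    -1 < x < 0 the values used are at x + 2 and x + 1.  At a negative integer
    both sides are zero. *)
Lemma GammaD1 (R : realType) (x : R) : x != 0 -> Gamma (x + 1) = x * Gamma x.
Proof.
move=> xn0; case: (ltrP 0 x) => [x0|xle0].
  by rewrite !Gamma_gt0E ?addr_gt0 // euler_integralD1.
have x0 : x < 0 by rewrite lt_neqAle xn0.
have [k fx] : exists k : nat, Num.floor x = - k.+1%:Z.
  have : Num.floor x < 0 by rewrite floor_lt0.
  by case: (Num.floor x) => // n _; exists n; rewrite NegzE.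
(* At x = -1 the shifted argument 0 is still a pole. *)
have [xm1|xm1] := eqVneq x (- 1).
  rewrite xm1 addNr; have := Gamma_pole R 1; rewrite mulr1n => ->.
  by have := Gamma_pole R 0; rewrite oppr0 mulr0 => ->.
have fx1 : Num.floor (x + 1) = - k%:Z.
  by rewrite floorDrz // fx floor1; lia.
rewrite (Gamma_le0E xle0 fx) pochS.
case: k fx fx1 => [|k] fx fx1.
  have x1 : 0 < x + 1.
    rewrite lt_neqAle eq_sym addr_eq0 xm1 /=.
    by have := floor_le (x + 1); rewrite fx1.
  rewrite (Gamma_gt0E x1) pochS poch0 mulr1.
  rewrite [x + 2%:R](_ : _ = x + 1 + 1); last by ring.
  rewrite (euler_integralD1 x1).
  by field; rewrite xn0 gt_eqF.
rewrite (Gamma_le0E _ fx1); last first.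
  by apply/ltW; rewrite -floor_lt0 fx1.
rewrite -addrA nat1r invfM; move: (_^-1) (euler_integral _) => P e.
by field.
Qed.

Lemma Gamma_shift (R : realType) (x : R) (n : nat) :
  (forall i, (i < n)%N -> x != - i%:R) -> Gamma (x + n%:R) = poch x n * Gamma x.
Proof.
elim: n => [|n IH] hx; first by rewrite addr0 poch0 mul1r.
rewrite -natr1 addrA GammaD1; last by rewrite addr_eq0 hx.
by rewrite IH ?pochSr 1?mulrA 1?[_ * poch _ _]mulrC // => i hi; apply/hx/leqW.
Qed.

(** Shifting x into the positive half-line multiplies Gamma x by a finite
    factor and ends at a positive value. *)
Lemma Gamma_neq0 (R : realType) (x : R) :
  (forall k : nat, x != - k%:R) -> Gamma x != 0.
Proof.
move=> hx; pose n := (Num.truncn (- x)).+1.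
have x0 : 0 < x + n%:R by rewrite addrC -[x]opprK subr_gt0 truncnS_gt.
have := euler_integral_gt0 x0; rewrite -Gamma_gt0E // Gamma_shift // => H.
by apply/eqP => G0; rewrite G0 mulr0 ltxx in H.
Qed.

Lemma Gamma_fact (R : realType) (n : nat) : Gamma (n.+1%:R : R) = n`!%:R.
Proof.
rewrite -nat1r Gamma_shift; last first.
  by move=> i _; rewrite -addr_eq0 nat1r pnatr_eq0.
by rewrite (poch_natE R 0) fact0 divr1 Gamma_gt0E // euler_integral1 mulr1.
Qed.

(** For b > -1 this is term by term integration; it removes the distinction
    between the integral and the functional given by its moments. *)
Lemma laguerre_integralE (R : realType) (b : R) (p : {poly R}) :
  laguerre_integral b p = \sum_(k < size p) p`_k * Gamma (b + k%:R + 1).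
Proof.
rewrite /laguerre_integral; case: ifP => // b1.
have bk0 (k : nat) : 0 < b + k%:R + 1.
  by rewrite addrAC ltr_wpDr // -ltrBlDr sub0r.
have intS n : integrable_pos
   (fun t : R => \sum_(k < n) p`_k * gamma_density (b + k%:R + 1) t).
  elim: n => [|n IH].
    rewrite (_ : (fun t : R => _) = (fun t : R => 0 * gamma_density 1 t)).
      exact/integrable_posZ/integrable_gamma_density.
    by apply/funext => t; rewrite big_ord0 mul0r.
  rewrite (_ : (fun t : R => _) = (fun t : R =>
    \sum_(k < n) p`_k * gamma_density (b + k%:R + 1) t
    + p`_n * gamma_density (b + n%:R + 1) t)).
    apply: integrable_posD => //.
    exact/integrable_posZ/integrable_gamma_density.
  by apply/funext => t; rewrite big_ord_recr.
transitivity (\int[lebesgue_measure]_(t in `](0 : R), +oo[)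
   \sum_(k < size p) p`_k * gamma_density (b + k%:R + 1) t).
  apply: eq_Rintegral => t; rewrite inE /= in_itv /= andbT => t0.
  rewrite horner_coef mulr_suml; apply: eq_bigr => k _.
  rewrite -mulrA; congr (_ * _); rewrite mulrA /gamma_density addrK.
  rewrite powRD; last by rewrite (gt_eqF t0) implybT.
  by rewrite powR_mulrn ?ltW // [t `^ b * _]mulrC.
elim: (size p) => [|n IH].
  rewrite big_ord0; under eq_Rintegral do rewrite big_ord0.
  by rewrite Rintegral_cst // mul0r.
rewrite big_ord_recr /= -IH Gamma_gt0E // euler_integralE.
rewrite -RintegralZl //; last exact: integrable_gamma_density.
rewrite -RintegralD //; last exact/integrable_posZ/integrable_gamma_density.
by apply: eq_Rintegral => t _; rewrite big_ord_recr.
exact: intS.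
Qed.

(** * Moments of Laguerre polynomials *)

(** Chu-Vandermonde.  By Pascal's rule the sum for (n + 1, a) is the sum over
    j <= n of ((a + j) - (c + j)) times the j-th term for (n, a + 1), and the
    factor a - c does not depend on j. *)
Lemma sum_poch_vandermonde (R : realType) (n : nat) (a c : R) :
  \sum_(j < n.+1) (-1) ^+ j * 'C(n, j)%:R * poch c j * poch (a + j%:R) (n - j)
  = poch (a - c) n.
Proof.
elim: n a => [|n IH] a.
  by rewrite big_ord_recl big_ord0 !poch0 bin0 expr0 !mulr1 addr0.
rewrite pochS -(addrAC a) -IH.
set G := fun j : nat => (-1) ^+ j * 'C(n, j)%:R * poch c j *
                poch (a + 1 + j%:R) (n - j).
transitivity (\sum_(j < n.+1) (a + j%:R) * G j
              - \sum_(j < n.+1) (c + j%:R) * G j); last first.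
  rewrite -sumrB mulr_sumr; apply: eq_bigr => j _.
  by rewrite -mulrBl opprD addrACA subrr addr0.
rewrite big_ord_recl [X in X - _]big_ord_recl.
have -> : (-1) ^+ (ord0 : 'I_n.+2) * 'C(n.+1, (ord0 : 'I_n.+2))%:R
    * poch c (ord0 : 'I_n.+2) * poch (a + (ord0 : 'I_n.+2)%:R)
         (n.+1 - (ord0 : 'I_n.+2))
  = (a + (ord0 : 'I_n.+1)%:R) * G (ord0 : 'I_n.+1).
  by rewrite /G /= !addr0 !subn0 !bin0 pochS !mulr1 !expr0 poch0 !mul1r.
rewrite -addrA; congr (_ + _).
(* The binomial coefficient of the added last term j = n + 1 is zero. *)
have S1 : \sum_(i < n) (a + (lift ord0 i)%:R) * G (lift ord0 i)
   = \sum_(i < n.+1) (a + i.+1%:R) * G i.+1.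
  by rewrite big_ord_recr /= /G bin_small // mulr0 !mul0r mulr0 addr0.
rewrite S1 -sumrB; apply: eq_bigr => j _ /=.
rewrite /G /bump leq0n add1n subSS binS natrD pochSr exprS.
have jn : (j <= n)%N by rewrite -ltnS.
have [->|jltn] := eqVneq (j : nat) n.
  by rewrite subnn !poch0 bin_small // binn; ring.
have -> : (n - j)%N = (n - j.+1).+1 by lia.
rewrite (pochS (a + _)).
rewrite (_ : a + 1 + j%:R = a + j.+1%:R); last by rewrite -addrA nat1r.
rewrite (_ : a + 1 + j.+1%:R = a + j.+1%:R + 1); last by rewrite addrAC.
rewrite !pochS; ring.
Qed.

Lemma gbinom_poch (R : realType) (n j : nat) (alpha : R) : (j <= n)%N ->
  gbinom (n%:R + alpha) (n - j) = poch (alpha + j.+1%:R) (n - j) / (n - j)`!%:R.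
Proof.
move=> jn; rewrite /gbinom /poch (reindex_inj rev_ord_inj) /=; congr (_ / _).
apply: eq_bigr => i _; have := ltn_ord i; set k := (n - j)%N => ik.
have -> : n = (k - i.+1 + (i + j.+1))%N by rewrite /k in ik *; lia.
by rewrite !natrD; ring.
Qed.

Lemma laguerre_integral_linear (R : realType) (b c : R) (p q : {poly R}) :
  laguerre_integral b (c *: p + q)
  = c * laguerre_integral b p + laguerre_integral b q.
Proof.
have E (N : nat) (r : {poly R}) : (size r <= N)%N ->
    laguerre_integral b r = \sum_(k < N) r`_k * Gamma (b + k%:R + 1).
  move=> rN; rewrite laguerre_integralE.
  rewrite (big_ord_widen N (fun k => r`_k * Gamma (b + k%:R + 1)) rN).
  rewrite [RHS](bigID (fun k : 'I_N => (k < size r)%N)) /=.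
  rewrite [X in _ = _ + X]big1 ?addr0 // => k.
  by rewrite -leqNgt => kr; rewrite nth_default ?mul0r.
set N := maxn (size (c *: p + q)) (maxn (size p) (size q)).
rewrite !(E N) ?leq_max ?leqnn ?orbT // mulr_sumr -big_split /=.
by apply: eq_bigr => k _; rewrite coefD coefZ mulrDl mulrA.
Qed.

Lemma laguerre_integralXn (R : realType) (b : R) (k : nat) :
  laguerre_integral b 'X^k = Gamma (b + k%:R + 1).
Proof.
rewrite laguerre_integralE size_polyXn big_ord_recr /= coefXn eqxx mul1r.
by rewrite big1 ?add0r // => i _; rewrite coefXn ltn_eqF ?mul0r.
Qed.

Lemma linear_form_sum (R : realType) (f : {poly R} -> R) (I : Type)
    (r : seq I) (c : I -> R) (g : I -> {poly R}) :
  (forall a p q, f (a *: p + q) = a * f p + f q) ->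
  f (\sum_(i <- r) c i *: g i) = \sum_(i <- r) c i * f (g i).
Proof.
move=> flin; elim: r => [|i r IH]; last by rewrite !big_cons flin IH.
by rewrite !big_nil; have := flin (-1) 0 0; rewrite scaler0 addr0 mulN1r addNr.
Qed.

(** No moment of mu_(alpha-m) is evaluated at a pole of Gamma. *)
Lemma moment_argument_nonpole (R : realType) (alpha : R) (m k : nat) :
  (forall i : nat, alpha != m%:R - i.+1%:R) ->
  forall i : nat, alpha - m%:R + k.+1%:R != - i%:R.
Proof.
move=> halpha i; rewrite -subr_eq0; apply/eqP => H.
have /eqP := halpha (k + i)%N; apply.
by move: H; rewrite -[(k + i).+1]addSn natrD => H; lra.
Qed.

(** With c = alpha - m + k + 1, the j-th term carries Gamma (c + j) =
    Gamma c (c)_j, and the sum becomes the Chu-Vandermonde sum with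
    a = alpha + 1, for which a - c = m - k. *)
Lemma laguerre_moment (R : realType) (alpha : R) (m k n : nat) :
  (forall i : nat, alpha != m%:R - i.+1%:R) ->
  laguerre_integral (alpha - m%:R) ('X^k * laguerre n alpha)
  = Gamma (alpha - m%:R + k.+1%:R) / n`!%:R * poch (m%:R - k%:R) n.
Proof.
move=> halpha; pose c := alpha - m%:R + k.+1%:R.
rewrite /laguerre poly_def mulr_sumr.
under eq_bigr => j _ do rewrite -scalerAr -exprD.
rewrite linear_form_sum; last exact: laguerre_integral_linear.
have -> : poch (m%:R - k%:R) n = poch (alpha + 1 - c) n.
  by congr poch; rewrite /c -natr1; ring.
rewrite -sum_poch_vandermonde mulr_sumr; apply: eq_bigr => j _.
have jn : (j <= n)%N by rewrite -ltnS.
rewrite laguerre_integralXn gbinom_poch //.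
have -> : alpha - m%:R + (k + j)%:R + 1 = c + j%:R.
  by rewrite /c natrD -natr1; ring.
rewrite Gamma_shift; last by move=> i _; exact: moment_argument_nonpole.
rewrite -(bin_fact jn) !natrM.
rewrite (_ : alpha + j.+1%:R = alpha + 1 + j%:R); last by rewrite -nat1r addrA.
field.
by rewrite !natr_fact_neq0 pnatr_eq0 -lt0n bin_gt0 jn.
Qed.

(** * The Sobolev form on monomials and Laguerre polynomials *)

Lemma horner0_derivn (R : realType) (p : {poly R}) (i : nat) :
  (p^`(i)).[0] = i`!%:R * p`_i.
Proof. by rewrite horner_coef0 coef_derivn addn0 ffactnn mulr_natl. Qed.

Lemma jet_form (R : realType) (m : nat) (M : 'M[R]_m) (p q : {poly R}) :
  (jet0 m p *m M *m (jet0 m q)^T) ord0 ord0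
  = \sum_(i < m) \sum_(j < m) i`!%:R * p`_i * M i j * (j`!%:R * q`_j).
Proof.
rewrite mxE exchange_big /=; apply: eq_bigr => j _; rewrite mxE mulr_suml.
by apply: eq_bigr => i _; rewrite !mxE !horner0_derivn.
Qed.

Lemma sobolev_form_linearr (R : realType) (m : nat) (alpha : R) (M : 'M[R]_m)
    (p : {poly R}) (c : R) (q r : {poly R}) :
  sobolev_form alpha M p (c *: q + r)
  = c * sobolev_form alpha M p q + sobolev_form alpha M p r.
Proof.
rewrite /sobolev_form mulrDr -scalerAr laguerre_integral_linear !jet_form.
rewrite mulrDr addrACA; congr (_ + _).
rewrite mulr_sumr -big_split; apply: eq_bigr => i _ /=.
rewrite mulr_sumr -big_split; apply: eq_bigr => j _ /=.
rewrite coefD coefZ; ring.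
Qed.

Lemma sobolev_form_tr (R : realType) (m : nat) (alpha : R) (M : 'M[R]_m)
    (p q : {poly R}) :
  sobolev_form alpha M^T p q = sobolev_form alpha M q p.
Proof.
rewrite /sobolev_form mulrC !jet_form exchange_big; congr (_ + _).
apply: eq_bigr => i _; apply: eq_bigr => j _; rewrite mxE; ring.
Qed.

Lemma sobolev_form_linearl (R : realType) (m : nat) (alpha : R) (M : 'M[R]_m)
    (q : {poly R}) (c : R) (p r : {poly R}) :
  sobolev_form alpha M (c *: p + r) q
  = c * sobolev_form alpha M p q + sobolev_form alpha M r q.
Proof. by rewrite -!(sobolev_form_tr alpha M) sobolev_form_linearr. Qed.

Lemma sobolev_form_Xn_ge (R : realType) (m : nat) (alpha : R) (M : 'M[R]_m)
    (k : nat) (q : {poly R}) : (m <= k)%N ->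
  sobolev_form alpha M 'X^k q = laguerre_integral (alpha - m%:R) ('X^k * q).
Proof.
move=> mk; rewrite /sobolev_form jet_form big1 ?addr0 // => i _.
rewrite big1 // => j _; rewrite coefXn ltn_eqF ?mulr0 ?mul0r //.
exact: leq_trans mk.
Qed.

Lemma sobolev_form_Xn_lt (R : realType) (m : nat) (alpha : R) (M : 'M[R]_m)
    (l : 'I_m) (q : {poly R}) :
  sobolev_form alpha M 'X^l q = laguerre_integral (alpha - m%:R) ('X^l * q)
    + l`!%:R * \sum_(i < m) M l i * (i`!%:R * q`_i).
Proof.
rewrite /sobolev_form jet_form; congr (_ + _); rewrite (bigD1 l) //=.
rewrite [X in _ + X]big1 ?addr0 => [|i il].
  by rewrite mulr_sumr; apply: eq_bigr => i _; rewrite coefXn eqxx /=; ring.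
rewrite big1 // => j _.
by rewrite coefXn (_ : (i == l :> nat) = false) ?mulr0 ?mul0r //; exact/negbTE.
Qed.

Lemma Gamma_ratio_nat (R : realType) (m n : nat) (alpha : R) :
  (forall i : nat, alpha != m%:R - i.+1%:R) ->
  Gamma_ratio alpha n%:R = Gamma (alpha + n.+1%:R) / n`!%:R.
Proof.
move=> halpha; rewrite /Gamma_ratio.
case: ifP => [/andP[/natrP[a ->] _]|_].
  by rewrite natr1 natrK poch_natE -natrD addnS Gamma_fact addnC.
by rewrite nat1r Gamma_fact -addrA nat1r.
Qed.

(** If alpha is a natural number then alpha >= m > t, and the product
    (x + 1)_alpha contains the factor 0; otherwise 1 / Gamma (1 + x) is 0. *)
Lemma Gamma_ratio_neg (R : realType) (m t : nat) (alpha : R) :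
  (forall i : nat, alpha != m%:R - i.+1%:R) -> (t < m)%N ->
  Gamma_ratio alpha (- t.+1%:R) = 0.
Proof.
move=> halpha tm; rewrite /Gamma_ratio.
have Et : - t.+1%:R + 1 = - t%:R :> R by rewrite -nat1r; ring.
case: ifP => [/andP[/natrP[a Ea] _]|_]; last first.
  by rewrite [1 + _]addrC Et Gamma_pole invr0 mulr0.
apply/eqP; rewrite Et Ea natrK poch_negnat_eq0; apply: leq_trans tm _.
rewrite leqNgt; apply/negP => am.
have /eqP := halpha (m - a.+1)%N; apply.
by rewrite Ea -subSn // subSS natrB ?(ltnW am) // opprB addrCA subrr addr0.
Qed.

(** The first summand of calR is the moment: for k = m - l - 1, both
    (k + 1)_n / n! and (n + 1)_k / k! equal (n + k)! / (n! k!).  The second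
    summand is the jet part, the i-th derivative of L_n^alpha at 0 being
    (-1)^i binom (n + alpha) (n - i). *)
Lemma calR_form (R : realType) (m n : nat) (alpha : R) (M : 'M[R]_m)
    (l : 'I_m) :
  (forall i : nat, alpha != m%:R - i.+1%:R) ->
  sobolev_form alpha M 'X^l (laguerre n alpha) = calR alpha M l n%:R.
Proof.
move=> halpha; rewrite sobolev_form_Xn_lt laguerre_moment // /calR.
have n0 := natr_fact_neq0 R n.
have lm := ltn_ord l; congr (_ + _).
  set k := (m - l.+1)%N.
  have k0 := natr_fact_neq0 R k.
  rewrite (_ : m%:R - (l : nat)%:R = k.+1%:R :> R); last first.
    by rewrite -natrB 1?ltnW // /k; congr (_%:R); lia.
  by rewrite natr1 !poch_natE addnC; field; rewrite n0 k0.
rewrite -mulrA; congr (_ * _); rewrite mulr_sumr; apply: eq_bigr => i _.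
rewrite (Gamma_ratio_nat _ halpha) coef_poly ltnS.
have i0 := natr_fact_neq0 R i.
case: leqP => [le_in|lt_ni]; last first.
  have /eqP -> : poch (n%:R - (i : nat)%:R + 1 : R) i == 0.
    rewrite (_ : _ + 1 = - (i - n.+1)%:R); last first.
      by rewrite natrB // -natr1; ring.
    by rewrite poch_negnat_eq0; lia.
  by rewrite !mulr0.
rewrite gbinom_poch //.
have ni0 := natr_fact_neq0 R (n - i).
have -> : alpha + n.+1%:R = alpha + i.+1%:R + (n - i)%:R.
  by rewrite -addrA -natrD; congr (_ + _%:R); lia.
have hni (j : nat) : alpha + i.+1%:R != - j%:R.
  have := moment_argument_nonpole (m + i) halpha j.
  by rewrite -addnS natrD addrA subrK.
rewrite Gamma_shift //.
rewrite (_ : alpha + (i : nat)%:R + 1 = alpha + i.+1%:R); last first.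
  by rewrite -addrA natr1.
have G0 := Gamma_neq0 hni.
rewrite (_ : n%:R - (i : nat)%:R + 1 = (n - i).+1%:R); last first.
  by rewrite -natrB // natr1.
rewrite poch_natE subnK //; field.
by rewrite n0 ni0 i0 G0.
Qed.

(** Only the first summand survives, and the zeros of (x + 1)_(m-l-1) are
    -1, ..., -(m-l-1). *)
Lemma calR_neg_eq0 (R : realType) (m t : nat) (alpha : R) (M : 'M[R]_m)
    (l : 'I_m) :
  (forall i : nat, alpha != m%:R - i.+1%:R) -> (t < m)%N ->
  (calR alpha M l (- t.+1%:R) == 0) = (t < m - l.+1)%N.
Proof.
move=> halpha tm; rewrite /calR (Gamma_ratio_neg halpha tm) mulr0 mul0r addr0.
have -> : - t.+1%:R + 1 = - t%:R :> R by rewrite -nat1r; ring.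
rewrite mulf_eq0 poch_negnat_eq0 mulf_eq0 invr_eq0.
rewrite (negbTE (natr_fact_neq0 _ _)) orbF.
case: eqP => // /eqP H; exfalso; move: H; apply/negP.
exact/Gamma_neq0/moment_argument_nonpole.
Qed.

Lemma sobolev_form_high (R : realType) (m n k : nat) (alpha : R) (M : 'M[R]_m) :
  (forall i : nat, alpha != m%:R - i.+1%:R) -> (m <= k)%N ->
  (sobolev_form alpha M 'X^k (laguerre n alpha) == 0) = (k < n + m)%N.
Proof.
move=> halpha mk; rewrite sobolev_form_Xn_ge // laguerre_moment //.
have -> : m%:R - k%:R = - (k - m)%:R :> R by rewrite natrB // opprB.
rewrite mulf_eq0 poch_negnat_eq0 mulf_eq0 invr_eq0.
rewrite (negbTE (natr_fact_neq0 _ _)) orbF ltn_subLR // [(m + n)%N]addnC.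
case: eqP => // /eqP H; exfalso; move: H; apply/negP.
exact/Gamma_neq0/moment_argument_nonpole.
Qed.

(** * Gram matrices and orthogonal sequences *)

Definition gram (R : realType) (B : {poly R} -> {poly R} -> R) (n : nat) :
  'M[R]_n := \matrix_(i < n, j < n) B 'X^i 'X^j.

Lemma poly_sum_Xn (R : realType) (n : nat) (p : {poly R}) : (size p <= n)%N ->
  p = \sum_(i < n) p`_i *: 'X^i.
Proof.
move=> pn; rewrite -poly_def; apply/polyP => i; rewrite coef_poly.
by case: ltnP => // ni; rewrite nth_default // (leq_trans pn).
Qed.

(** If Q is the triangular matrix of coefficients of q_0, ..., q_(n-1), then
    the product of Q and the Gram matrix has the entries B (q_i) (x^j): it is
    triangular on the other side, with nonzero diagonal. *)
Lemma left_orthogonal_gram (R : realType) (B : {poly R} -> {poly R} -> R)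
    (q : nat -> {poly R}) :
  (forall r c p1 p2, B (c *: p1 + p2) r = c * B p1 r + B p2 r) ->
  (forall r c p1 p2, B r (c *: p1 + p2) = c * B r p1 + B r p2) ->
  left_orthogonal B q -> forall n, \det (gram B n) != 0.
Proof.
move=> Bl Br oq n; pose Q : 'M[R]_n := \matrix_(i, j) (q i)`_j.
have QG : Q *m gram B n = \matrix_(i, j) B (q i) 'X^j.
  apply/matrixP => i j; have [sz _ _] := oq i.
  rewrite !mxE (@poly_sum_Xn _ n (q i)) ?sz //.
  rewrite (linear_form_sum (f := B^~ 'X^j)) //.
  by apply: eq_bigr => k _; rewrite !mxE.
have QGtrig : is_trig_mx (Q *m gram B n)^T.
  apply/is_trig_mxP => i j ij; rewrite QG !mxE.
  by have [_ o _] := oq j; rewrite o ?size_polyXn.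
have : \det (Q *m gram B n) != 0.
  rewrite -det_tr det_trig //; apply/prodf_neq0 => i _; rewrite QG !mxE.
  have [sz o nz] := oq i; apply: contraNneq nz => B0.
  rewrite [X in B _ X](@poly_sum_Xn _ i.+1) ?sz //.
  rewrite linear_form_sum // big_ord_recr /= B0 mulr0 addr0 big1 // => k _.
  by rewrite o ?mulr0 // size_polyXn.
by rewrite det_mulmx mulf_eq0 negb_or => /andP[].
Qed.

Lemma gram_kernel (R : realType) (B : {poly R} -> {poly R} -> R) (n : nat)
    (p : {poly R}) :
  (forall r c p1 p2, B r (c *: p1 + p2) = c * B r p1 + B r p2) ->
  \det (gram B n) != 0 -> (size p <= n)%N ->
  (forall i, (i < n)%N -> B 'X^i p = 0) -> p = 0.
Proof.
move=> Br G0 pn o; pose v : 'cV[R]_n := \col_i p`_i.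
have Gu : gram B n \in unitmx by rewrite unitmxE unitfE.
have Gv : gram B n *m v = 0.
  apply/matrixP => i j; rewrite !mxE -[RHS](o i (ltn_ord i)).
  rewrite [in RHS](poly_sum_Xn pn) linear_form_sum //.
  by apply: eq_bigr => k _; rewrite !mxE mulrC.
have v0 : v = 0 by rewrite -[v](mulKmx Gu) Gv mulmx0.
rewrite (poly_sum_Xn pn) big1 // => i _.
by move/matrixP: v0 => /(_ i ord0); rewrite !mxE => ->; rewrite scale0r.
Qed.

(** * The determinantal polynomials *)

Lemma det_col_mx_row (S : comNzRingType) (m : nat) (t : 'rV[S]_(1 + m))
    (A : 'M[S]_(m, 1 + m)) :
  \det (col_mx t A) = \sum_j t 0 j * ((-1) ^+ j * \det (col' j A)).
Proof.
rewrite (expand_det_row _ (lshift m 0)); apply: eq_bigr => j _.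
rewrite col_mxEu /cofactor add0n; congr (_ * (_ * \det _)).
apply/matrixP => i k; rewrite !mxE.
have -> : lift (lshift m 0) i = rshift 1 i by apply/val_inj.
by case: splitP => [[[]]|i' /= /addnI /val_inj ->].
Qed.

Definition calR_mx (R : realType) (m : nat) (alpha : R) (M : 'M[R]_m)
    (n : nat) : 'M[R]_(m, 1 + m) :=
  \matrix_(i, j) calR alpha M i (n%:R - j%:R).

(** The cofactor of the entry L_(n-j) in the first row. *)
Definition sobolev_coef (R : realType) (m : nat) (alpha : R) (M : 'M[R]_m)
    (n : nat) (j : 'I_(1 + m)) : R :=
  (-1) ^+ j * \det (col' j (calR_mx alpha M n)).

Lemma sobolev_polyE (R : realType) (m : nat) (alpha : R) (M : 'M[R]_m)
    (n : nat) :
  sobolev_poly alpha M n = \sum_j sobolev_coef alpha M n j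
    *: (if (j <= n)%N then laguerre (n - j) alpha else 0).
Proof.
rewrite /sobolev_poly det_col_mx_row; apply: eq_bigr => j _.
rewrite mxE mulrC -mul_polyC /sobolev_coef polyCM; congr (_ * _ * _).
  by rewrite rmorphXn rmorphN1.
rewrite -det_map_mx; congr (\det _).
by apply/matrixP => i k; rewrite !mxE.
Qed.

(** The determinant in which a row of calR_mx also stands as first row. *)
Lemma sobolev_coef_row (R : realType) (m : nat) (alpha : R) (M : 'M[R]_m)
    (n : nat) (l : 'I_m) :
  \sum_(j < 1 + m) calR alpha M l (n%:R - j%:R) * sobolev_coef alpha M n j = 0.
Proof.
have := det_col_mx_row (row l (calR_mx alpha M n)) (calR_mx alpha M n).
rewrite (determinant_alternate (i1 := lshift m 0) (i2 := rshift 1 l)) //.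
  by move=> E; rewrite [RHS]E; apply: eq_bigr => j _; rewrite !mxE.
by move=> j; rewrite col_mxEu col_mxEd mxE.
Qed.

Lemma sobolev_coef0 (R : realType) (m : nat) (alpha : R) (M : 'M[R]_m)
    (n : nat) :
  sobolev_coef alpha M n ord0 = casorati alpha M n.
Proof.
rewrite /sobolev_coef expr0 mul1r; congr (\det _).
by apply/matrixP => i j; rewrite !mxE.
Qed.

Lemma sobolev_coef_max (R : realType) (m : nat) (alpha : R) (M : 'M[R]_m)
    (n : nat) :
  sobolev_coef alpha M n ord_max = (-1) ^+ m * casorati alpha M n.+1.
Proof.
rewrite /sobolev_coef; congr (_ * \det _); apply/matrixP => i j; rewrite !mxE.
congr calR; rewrite lift_max -!natr1; ring.
Qed.

(** The row of pairings of x^k with the first row of the determinant is, for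
    k < m, a row of calR_mx except when k = n, where calR at n - m < 0 is not
    zero but the corresponding pairing is; for k >= m it is zero except for the
    pairing of x^n with L_(n-m).  So only the last cofactor, which is
    Omega(n + 1) up to sign, can contribute. *)
Lemma sobolev_poly_pairing (R : realType) (m : nat) (alpha : R) (M : 'M[R]_m)
    (n k : nat) :
  (forall i : nat, alpha != m%:R - i.+1%:R) -> (k <= n)%N ->
  exists2 kappa : R, kappa != 0 &
    sobolev_form alpha M 'X^k (sobolev_poly alpha M n)
    = (k == n)%:R * kappa * casorati alpha M n.+1.
Proof.
move=> halpha kn.
suff [kappa k0 E] : exists2 kappa : R, kappa != 0 &
    sobolev_form alpha M 'X^k (sobolev_poly alpha M n)
    = (k == n)%:R * kappa * sobolev_coef alpha M n ord_max.
  exists (kappa * (-1) ^+ m); first by rewrite mulf_neq0 ?signr_eq0.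
  by rewrite E sobolev_coef_max !mulrA.
rewrite sobolev_polyE linear_form_sum; last exact: sobolev_form_linearr.
have [km|mk] := ltnP k m.
  pose l := Ordinal km.
  (* The pairings differ from a row of calR_mx only in the column j = m,
     and only when k = n. *)
  have pairE (j : 'I_(1 + m)) : sobolev_form alpha M 'X^k
        (if (j <= n)%N then laguerre (n - j) alpha else 0)
      = calR alpha M l (n%:R - j%:R)
        - ((k == n) && (j == ord_max))%:R * calR alpha M l (n%:R - j%:R).
    have jm : (j <= m)%N by rewrite -ltnS.
    case: leqP => [jn|nj].
      rewrite (calR_form _ _ l) // natrB //.
      suff /negbTE -> : ~~ ((k == n) && (j == ord_max)) by rewrite mul0r subr0.
      apply/andP => -[/eqP ek /eqP ej].
      by move: jn; rewrite ej /= -ek leqNgt km.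
    have -> : sobolev_form alpha M 'X^k 0 = 0.
      have := sobolev_form_linearr alpha M 'X^k (-1) 0 0.
      by rewrite scaler0 addr0 mulN1r addNr.
    case: andP => [[_ _]|kj]; first by rewrite mul1r subrr.
    rewrite mul0r subr0; apply/esym/eqP.
    have -> : n%:R - (j : nat)%:R = - (j - n.+1).+1%:R :> R.
      by rewrite -subSn // subSS natrB ?opprB // ltnW.
    rewrite calR_neg_eq0 //; last by lia.
    have : ~ (k = n /\ (j : nat) = m).
      by move=> [ek ej]; apply: kj; rewrite ek; split => //; apply/eqP/val_inj.
    by rewrite /=; lia.
  exists (if k == n then - calR alpha M l (n%:R - m%:R) else 1).
    case: (k =P n) => [ekn|_]; last by rewrite oner_eq0.
    rewrite oppr_eq0.
    have -> : n%:R - m%:R = - (m - n.+1).+1%:R :> R.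
      by rewrite -subSn -?ekn // subSS natrB ?opprB // ltnW.
    rewrite calR_neg_eq0 //; last by lia.
    by rewrite /= ekn ltnn.
  under eq_bigr => j _ do rewrite pairE mulrBr mulrC.
  rewrite sumrB sobolev_coef_row sub0r.
  case: (k =P n) => [_|_]; last first.
    by rewrite !mul0r big1 ?oppr0 // => j _; rewrite /= mul0r mulr0.
  rewrite (bigD1 ord_max) //= eqxx big1 ?addr0 => [|j /negbTE ->].
    by rewrite mulr1n !mul1r mulrC mulNr.
  by rewrite mul0r mulr0.
have mn := leq_trans mk kn.
exists (if k == n then sobolev_form alpha M 'X^k (laguerre (n - m) alpha)
        else 1).
  case: (k =P n) => [ekn|_]; last by rewrite oner_eq0.
  by rewrite sobolev_form_high // ekn subnK // ltnn.
have jn (j : 'I_(1 + m)) : (j <= n)%N.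
  by apply: leq_trans mn; rewrite -ltnS.
have low (j : 'I_(1 + m)) : ~~ ((k == n) && (j == ord_max)) ->
    sobolev_form alpha M 'X^k (laguerre (n - j) alpha) = 0.
  move=> kj; apply/eqP; rewrite sobolev_form_high //.
  have jm : (j <= m)%N by rewrite -ltnS.
  move: kj; rewrite -val_eqE /=; lia.
rewrite (bigD1 ord_max) //= big1 ?addr0 => [|j jmax]; last first.
  by rewrite jn low ?mulr0 // (negbTE jmax) andbF.
rewrite mn; case: (k =P n) => [_|kn']; first by rewrite mul1r mulrC.
by rewrite (low ord_max) ?mulr0 ?mul0r //; case: eqP.
Qed.

Lemma sobolev_poly_size (R : realType) (m : nat) (alpha : R) (M : 'M[R]_m)
    (n : nat) :
  casorati alpha M n != 0 -> size (sobolev_poly alpha M n) = n.+1.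
Proof.
move=> cas0.
have sz : (size (sobolev_poly alpha M n) <= n.+1)%N.
  rewrite sobolev_polyE; apply: (leq_trans (size_sum _ _ _)).
  apply/bigmax_leqP => j _; apply: (leq_trans (size_scale_leq _ _)).
  case: ifP => _; last by rewrite size_poly0.
  by apply: (leq_trans (size_poly _ _)); rewrite ltnS leq_subr.
apply/eqP; rewrite eqn_leq sz /= ltnNge; apply/negP => szn.
have : (sobolev_poly alpha M n)`_n = 0 by rewrite nth_default.
rewrite sobolev_polyE coef_sum big_ord_recl big1 ?addr0 => [|j _]; last first.
  rewrite coefZ; case: ifP => [jn|_]; last by rewrite coef0 mulr0.
  by rewrite coef_poly ifF ?mulr0 //; move: jn; rewrite /= /bump leq0n; lia.
rewrite leq0n subn0 coefZ coef_poly ltnSn subnn /gbinom big_ord0 fact0 divr1.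
rewrite mulr1 sobolev_coef0 => /eqP.
rewrite mulf_eq0 (negbTE cas0) /= mulf_eq0 signr_eq0.
by rewrite invr_eq0 (negbTE (natr_fact_neq0 _ _)).
Qed.

(** At x = -1, ..., -m the calR matrix is anti-triangular; reversing the order
    of the rows makes it triangular. *)
Lemma casorati0 (R : realType) (m : nat) (alpha : R) (M : 'M[R]_m) :
  (forall i : nat, alpha != m%:R - i.+1%:R) -> casorati alpha M 0 != 0.
Proof.
move=> halpha; rewrite /casorati; set A := (X in \det X).
have AE (i j : 'I_m) : (A i j == 0) = (j < m - i.+1)%N.
  by rewrite mxE sub0r calR_neg_eq0.
pose s := perm (@rev_ord_inj m).
have : \det (row_perm s A) != 0.
  rewrite -det_tr det_trig; last first.
    apply/is_trig_mxP => i j ij; rewrite !mxE permE.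
    have := AE (rev_ord j) i; rewrite mxE => H; apply/eqP; rewrite H /=.
    by move: (ltn_ord j) ij; lia.
  apply/prodf_neq0 => i _; rewrite 2!mxE AE permE /=.
  by have := ltn_ord i; lia.
by rewrite row_permE det_mulmx mulf_eq0 negb_or => /andP[].
Qed.

(** * Equivalence of orthogonality and nonvanishing Casorati determinants *)

(** If Omega(n + 1) were zero, then q_n, of degree n because Omega(n) is not
    zero, would be annihilated by 1, x, ..., x^n. *)
Lemma gram_casorati (R : realType) (m : nat) (alpha : R) (M : 'M[R]_m) :
  (forall i : nat, alpha != m%:R - i.+1%:R) ->
  (forall n, \det (gram (sobolev_form alpha M) n) != 0) ->
  forall n, casorati alpha M n != 0.
Proof.
move=> halpha G0; elim=> [|n IH]; first exact: casorati0.
apply/eqP => cas0; have sz := sobolev_poly_size IH.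
suff q0 : sobolev_poly alpha M n = 0 by move: sz; rewrite q0 size_poly0.
apply: (gram_kernel _ (G0 n.+1)); rewrite ?sz //.
  by move=> *; exact: sobolev_form_linearr.
move=> i; rewrite ltnS => /(sobolev_poly_pairing M halpha)[kappa _ ->].
by rewrite cas0 mulr0.
Qed.

Lemma casorati_right_orthogonal (R : realType) (m : nat) (alpha : R)
    (M : 'M[R]_m) :
  (forall i : nat, alpha != m%:R - i.+1%:R) ->
  (forall n, casorati alpha M n != 0) ->
  right_orthogonal (sobolev_form alpha M) (sobolev_poly alpha M).
Proof.
move=> halpha cas n; have sz := sobolev_poly_size (cas n).
have orth i : (i < n)%N ->
    sobolev_form alpha M 'X^i (sobolev_poly alpha M n) = 0.
  move=> lin; have [kappa _ ->] := sobolev_poly_pairing M halpha (ltnW lin).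
  by rewrite ltn_eqF // !mul0r.
have orthp (p : {poly R}) : (size p <= n)%N ->
    sobolev_form alpha M p (sobolev_poly alpha M n) = 0.
  move=> pn; rewrite (poly_sum_Xn pn).
  rewrite (linear_form_sum (f := (sobolev_form alpha M)^~ _)).
    by rewrite big1 // => i _; rewrite orth ?mulr0.
  by move=> *; exact: sobolev_form_linearl.
split => //.
rewrite [X in sobolev_form _ _ X](@poly_sum_Xn _ n.+1) ?sz //.
rewrite (linear_form_sum (f := (sobolev_form alpha M)^~ _)); last first.
  by move=> *; exact: sobolev_form_linearl.
rewrite big_ord_recr /= big1 ?add0r => [|i _]; last by rewrite orth ?mulr0.
have [kappa k0 ->] := sobolev_poly_pairing M halpha (leqnn n).
rewrite eqxx mul1r !mulf_neq0 //.
have : lead_coef (sobolev_poly alpha M n) != 0.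
  by rewrite lead_coef_eq0 -size_poly_eq0 sz.
by rewrite lead_coefE sz.
Qed.

Lemma left_orthogonal_casorati (R : realType) (m : nat) (alpha : R)
    (M : 'M[R]_m) (q : nat -> {poly R}) :
  (forall i : nat, alpha != m%:R - i.+1%:R) ->
  left_orthogonal (sobolev_form alpha M) q ->
  forall n, casorati alpha M n != 0.
Proof.
move=> halpha oq; apply: gram_casorati => //.
apply: (left_orthogonal_gram _ _ oq) => *.
  exact: sobolev_form_linearl.
exact: sobolev_form_linearr.
Qed.

(** The polynomials built from M are left orthogonal for the form of M^T,
    whose Casorati determinants are therefore nonzero too; the polynomials
    built from M^T are then right orthogonal for M^T, so left orthogonal
    for M. *)
Lemma casorati_left_orthogonal (R : realType) (m : nat) (alpha : R)
    (M : 'M[R]_m) :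
  (forall i : nat, alpha != m%:R - i.+1%:R) ->
  (forall n, casorati alpha M n != 0) ->
  left_orthogonal (sobolev_form alpha M) (sobolev_poly alpha M^T).
Proof.
move=> halpha /(casorati_right_orthogonal halpha) right.
have flip : (fun p1 p2 => sobolev_form alpha M p2 p1) = sobolev_form alpha M^T.
  by apply/funext => p; apply/funext => q; rewrite sobolev_form_tr.
move: right; rewrite /right_orthogonal flip.
move=> /(left_orthogonal_casorati halpha) /(casorati_right_orthogonal halpha).
rewrite /right_orthogonal.
by rewrite -flip.
Qed.

Theorem theorem1p1 (R : realType) (m : nat) (M : 'M[R]_m) (alpha : R)
    (hm : (1 <= m)%N)
    (halpha : forall k : nat, alpha != m%:R - k.+1%:R) :
  ((exists q : nat -> {poly R}, left_orthogonal (sobolev_form alpha M) q)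
   <-> (forall n : nat, casorati alpha M n != 0))
  /\ ((exists q : nat -> {poly R}, left_orthogonal (sobolev_form alpha M) q)
      \/ (forall n : nat, casorati alpha M n != 0) ->
      right_orthogonal (sobolev_form alpha M) (sobolev_poly alpha M)
      /\ left_orthogonal (sobolev_form alpha M) (sobolev_poly alpha M^T)).
Proof.
have iff :
    (exists q : nat -> {poly R}, left_orthogonal (sobolev_form alpha M) q)
    <-> (forall n : nat, casorati alpha M n != 0).
  split=> [[q oq]|cas]; first exact: left_orthogonal_casorati oq.
  by exists (sobolev_poly alpha M^T); exact: casorati_left_orthogonal.
split=> // h; have {h}cas : forall n, casorati alpha M n != 0.
  by case: h => // /iff.
by split; [exact: casorati_right_orthogonal|exact: casorati_left_orthogonal].
Qed.
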